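(* Let $S$ be a densely defined symmetric operator with equal defect numbers in a Hilbert space $\mathfrak{H}$ which commutes with a non-trivial fundamental symmetry $J$, and let $\{C_\alpha\}_{\alpha\in D}$ be the set of all $C$-symmetries of $S$. Let $(\mathcal{H},\Gamma_0,\Gamma_1)$ be a boundary triplet for $S^*$ such that the formulas $$\mathcal{C}_\alpha\Gamma_0 f=\Gamma_0C_\alpha f,\qquad \mathcal{C}_\alpha\Gamma_1 f=\Gamma_1C_\alpha f,\qquad \forall\alpha\in D,\ \forall f\in\mathcal{D}(S^* )$$ correctly define an operator family $\{\mathcal{C}_\alpha\}_{\alpha\in D}$ in $\mathcal{H}$. Then every $A\in\Sigma_J^{\mathsf{st}}$ admits the presentation $$A=S^*\upharpoonright\{f\in\mathcal{D}(S^* ) : \mathcal{K}\Omega_+f=\Omega_-f\},$$ where $\Omega_\pm=\frac{1}{\sqrt2}(\Gamma_1\pm i\Gamma_0)$ and $\mathcal{K}$ is a stable $\mathcal{J}$-unitary operator in the Krein space $(\mathcal{H},[\cdot,\cdot]_{\mathcal{J}})$.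
   Context: $\mathfrak{H}$ is a Hilbert space with inner product $(\cdot,\cdot)$. A fundamental symmetry is a bounded operator $J$ with $J=J^*$, $J^2=I$; it is non-trivial if $J\neq\pm I$. For a bounded operator $C$ and an operator $A$, ''$A$ commutes with $C$'', written $[A,C]=0$, means $AC=CA$ (including equality of domains). $\{C_\alpha\}_{\alpha\in D}$ denotes the set (indexed by a set $D$) of all bounded operators $C$ in $\mathfrak{H}$ with $C^2=I$, $JC>0$ (i.e. $JC$ is self-adjoint and $(JCx,x)>0$ for $x\ne0$) and $SC=CS$. It contains $J$. Each such $C$ also commutes with $S^*$. An operator $A$ is $J$-self-adjoint if it is densely defined and $A^*J=JA$. $\Sigma_J$ is the set of $J$-self-adjoint extensions $A\supset S$. $\Sigma_J^{\mathsf{st}}$ (stable $C$-symmetry) is the set of $A\in\Sigma_J$ such that $[A,C_\alpha]=0$ for at least one $\alpha\in D$. A boundary triplet for $S^*$ is a triplet $(\mathcal{H},\Gamma_0,\Gamma_1)$, where $\mathcal{H}$ is a Hilbert space and $\Gamma_0,\Gamma_1:\mathcal{D}(S^* )\to\mathcal{H}$ are linear, such that $(S^*x,y)-(x,S^*y)=(\Gamma_1x,\Gamma_0y)_{\mathcal{H}}-(\Gamma_0x,\Gamma_1y)_{\mathcal{H}}$ for all $x,y\in\mathcal{D}(S^* )$ and $(\Gamma_0,\Gamma_1):\mathcal{D}(S^* )\to\mathcal{H}\oplus\mathcal{H}$ is surjective. ''Correctly define'' means that for each $\alpha$ there is a single well-defined operator $\mathcal{C}_\alpha$ in $\mathcal{H}$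 satisfying both formulas. $\mathcal{J}$ denotes the operator $\mathcal{C}_\alpha$ corresponding to $C_\alpha=J$ (i.e. $\mathcal{J}\Gamma_j=\Gamma_jJ$); it is a fundamental symmetry in $\mathcal{H}$, and $[x,y]_{\mathcal{J}}=(\mathcal{J}x,y)_{\mathcal{H}}$. A bounded, boundedly invertible operator $\mathcal{K}$ in $\mathcal{H}$ is $\mathcal{J}$-unitary if $\mathcal{K}^*\mathcal{J}\mathcal{K}=\mathcal{J}$; it is stable if $\sup_{n\in\mathbb{Z}}\|\mathcal{K}^n\|<\infty$. *)

(* Defs.v *)
From HB Require Import structures.
From mathcomp Require Import all_boot all_order all_algebra sesquilinear.
From mathcomp Require Import complex.
From mathcomp Require Import all_classical all_reals all_analysis.

Set Implicit Arguments.
Unset Strict Implicit.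
Unset Printing Implicit Defensive.

Import Order.TTheory GRing.Theory Num.Theory.
Import numFieldNormedType.Exports.

Local Open Scope classical_set_scope.
Local Open Scope ring_scope.

(* The inner product is linear in its first argument and conjugate-linear in
   the second; the norm of a normed module over R[i] takes values in R[i]. *)
HB.mixin Record isHilbert (R : realType) H
    of CompleteNormedModule R[i] H := {
  inner_form : {dot H for (@Num.conj R[i])};
  inner_normE : forall x : H, `|x| ^+ 2 = inner_form x x }.

#[short(type="hilbertType")]
HB.structure Definition Hilbert (R : realType) :=
  {H of isHilbert R H & CompleteNormedModule R[i] H}.

Definition inner (R : realType) (H : hilbertType R) (x y : H) : R[i] :=
  @inner_form R H x y.

Reserved Notation "⟪ x , y ⟫" (at level 0, x, y at level 99,
  format "⟪ x ,  y ⟫").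
Notation "⟪ x , y ⟫" := (inner x y) : ring_scope.

(* Linear relations and unbounded operators are represented by their graphs,
   so that equality of sets is equality of operators together with equality of
   their domains, and inclusion of sets is extension of operators. *)
Section Graphs.
Context {R : realType} {H : hilbertType R}.
Implicit Types (T U : set (H * H)) (f : H -> H).

Definition dom T : set H := [set x | exists y, T (x, y)].

Definition gr f : set (H * H) := [set p | p.2 = f p.1].

(* The product T U, with its natural domain {x in D(U) | U x in D(T)}. *)
Definition comp T U : set (H * H) :=
  [set p | exists z, U (p.1, z) /\ T (z, p.2)].

Definition commutes T f : Prop := comp T (gr f) = comp (gr f) T.

Definition is_operator T : Prop :=
  [/\ T (0, 0),
      forall (a : R[i]) x x' y y',
        T (x, x') -> T (y, y') -> T (a *: x + y, a *: x' + y') &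
      forall x y y', T (x, y) -> T (x, y') -> y = y'].

(* For T densely defined this is the graph of the adjoint operator. *)
Definition adjoint T : set (H * H) :=
  [set p | forall x x', T (x, x') -> ⟪x', p.1⟫ = ⟪x, p.2⟫].

Definition symmetric_operator T : Prop :=
  [/\ is_operator T, dense (dom T) & T `<=` adjoint T].

Definition self_adjoint T : Prop := adjoint T = T.

Definition bounded_op f : Prop := bounded_near f (nbhs (0 : H)).

Definition op_norm f : \bar R :=
  ereal_sup [set (complex.Re `|f x|)%:E | x in [set x : H | `|x| <= 1]].

Definition orthonormal_basis (N B : set H) : Prop :=
  [/\ B `<=` N,
      forall b b', B b -> B b' -> ⟪b, b'⟫ = (b == b')%:R &
      forall x, N x -> (forall b, B b -> ⟪x, b⟫ = 0) -> x = 0].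

Definition defect_subspace T (z : R[i]) : set H :=
  [set x | adjoint T (x, z *: x)].

(* Defect numbers are Hilbert dimensions, i.e., possibly infinite cardinals. *)
Definition equal_defect_numbers T : Prop :=
  exists Bp Bm : set H,
    [/\ orthonormal_basis (defect_subspace T 'i) Bp,
        orthonormal_basis (defect_subspace T (- 'i)) Bm & (Bp #= Bm)%card].

Definition fundamental_symmetry (J : {linear H -> H}) : Prop :=
  [/\ bounded_op J, self_adjoint (gr J) & forall x, J (J x) = x].

Definition nontrivial_op (J : {linear H -> H}) : Prop :=
  ~ (forall x, J x = x) /\ ~ (forall x, J x = - x).

Definition C_symmetry T (J C : {linear H -> H}) : Prop :=
  [/\ bounded_op C,
      forall x, C (C x) = x,
      self_adjoint (gr (J \o C)),
      forall x, x != 0 -> 0 < ⟪J (C x), x⟫ &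
      commutes T C].

Definition J_self_adjoint (J : {linear H -> H}) T : Prop :=
  [/\ is_operator T, dense (dom T) & comp (adjoint T) (gr J) = comp (gr J) T].

Definition SigmaJ T (J : {linear H -> H}) (A : set (H * H)) : Prop :=
  J_self_adjoint J A /\ T `<=` A.

Definition SigmaJ_st T (J : {linear H -> H}) (A : set (H * H)) : Prop :=
  SigmaJ T J A /\ exists C : {linear H -> H}, C_symmetry T J C /\ commutes A C.

Definition J_unitary (J K : {linear H -> H}) : Prop :=
  [/\ bounded_op K,
      exists L : {linear H -> H}, [/\ bounded_op L, cancel K L & cancel L K] &
      comp (adjoint (gr K)) (comp (gr J) (gr K)) = gr J].

(* L plays the role of the inverse of K. *)
Definition op_zpow (K L : H -> H) (n : int) : H -> H :=
  match n with Posz k => iter k K | Negz k => iter k.+1 L end.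

Definition stable_op (K : {linear H -> H}) : Prop :=
  exists L : {linear H -> H}, [/\ cancel K L, cancel L K &
    (ereal_sup [set op_norm (op_zpow K L n) | n in [set: int]] < +oo)%E].

End Graphs.

Section BoundaryTriplets.
Context {R : realType} {H Hb : hilbertType R}.
Implicit Types S : set (H * H).

Definition linear_on (D : set H) (G : H -> Hb) : Prop :=
  forall (a : R[i]) x y, D x -> D y -> G (a *: x + y) = a *: G x + G y.

(* The boundary maps are only meaningful on the domain of the adjoint of S;
   their values elsewhere are irrelevant. *)
Definition boundary_triplet S (G0 G1 : H -> Hb) : Prop :=
  [/\ linear_on (dom (adjoint S)) G0,
      linear_on (dom (adjoint S)) G1,
      forall x x' y y', adjoint S (x, x') -> adjoint S (y, y') ->
        ⟪x', y⟫ - ⟪x, y'⟫ = ⟪G1 x, G0 y⟫ - ⟪G0 x, G1 y⟫ &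
      forall u v : Hb, exists f,
        [/\ dom (adjoint S) f, G0 f = u & G1 f = v]].

Definition boundary_image S (G0 G1 : H -> Hb) (C : {linear H -> H})
    (cC : {linear Hb -> Hb}) : Prop :=
  forall f, dom (adjoint S) f ->
    cC (G0 f) = G0 (C f) /\ cC (G1 f) = G1 (C f).

Definition Omega_plus (G0 G1 : H -> Hb) (f : H) : Hb :=
  (sqrtC (2 : R[i]))^-1 *: (G1 f + 'i *: G0 f).

Definition Omega_minus (G0 G1 : H -> Hb) (f : H) : Hb :=
  (sqrtC (2 : R[i]))^-1 *: (G1 f - 'i *: G0 f).

End BoundaryTriplets.

(* Main.v *)
(** Put [G = JC], a bounded, self-adjoint, uniformly positive operator commuting
    with [S*], and let [cG] be the operator it induces on the boundary space.
    Any self-adjoint [T] commuting with [S*] satisfies [|cT| <= |T|]; applied to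
    [T = G] and [T = N - G], this makes [cG] bounded and uniformly positive, so
    that [(cG x, y)] is an equivalent inner product.  As [A] commutes with [C]
    and [A* J = J A], the relation [Th = {(G0 f, G1 f) | f in D(A)}] is
    self-adjoint for [(cG x, y)] and symmetric for [(cJ x, y)].  Its Cayley
    transform [K] is therefore [cG]-unitary, hence stable, and [cJ]-unitary. *)

Require Import Defs.
From HB Require Import structures.
From mathcomp Require Import all_boot all_order all_algebra sesquilinear.
From mathcomp Require Import complex.
From mathcomp Require Import all_classical all_reals all_analysis.
From mathcomp Require Import ring lra.

Set Implicit Arguments.
Unset Strict Implicit.
Unset Printing Implicit Defensive.

Import Order.TTheory GRing.Theory Num.Theory.
Import numFieldNormedType.Exports.

Local Open Scope classical_set_scope.
Local Open Scope ring_scope.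

(** * Inner product calculus and its real part *)

Section InnerProduct.
Local Open Scope complex_scope.
Context {R : realType} {H : hilbertType R}.
Implicit Types (x y z : H) (a : R[i]) (r : R).

Lemma innerDl x y z : ⟪x + y, z⟫ = ⟪x, z⟫ + ⟪y, z⟫.
Proof. exact: linearDl. Qed.

Lemma innerDr x y z : ⟪x, y + z⟫ = ⟪x, y⟫ + ⟪x, z⟫.
Proof. exact: linearDr. Qed.

Lemma innerBl x y z : ⟪x - y, z⟫ = ⟪x, z⟫ - ⟪y, z⟫.
Proof. exact: linearBl. Qed.

Lemma innerBr x y z : ⟪x, y - z⟫ = ⟪x, y⟫ - ⟪x, z⟫.
Proof. exact: linearBr. Qed.

Lemma innerZl a x y : ⟪a *: x, y⟫ = a * ⟪x, y⟫.
Proof. exact: linearZl_LR. Qed.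

Lemma innerZr a x y : ⟪x, a *: y⟫ = Num.conj a * ⟪x, y⟫.
Proof. exact: linearZr_LR. Qed.

Lemma inner0l x : ⟪0, x⟫ = 0.
Proof. exact: linear0l. Qed.

Lemma inner0r x : ⟪x, 0⟫ = 0.
Proof. exact: linear0r. Qed.

Lemma innerC x y : ⟪x, y⟫ = Num.conj ⟪y, x⟫.
Proof. by rewrite [LHS](hermC (@inner_form R H)) expr0 mul1r. Qed.

Lemma conjc_i : Num.conj 'i%R = - 'i%R :> R[i].
Proof. exact: conjCi. Qed.

(** The real part makes [H] a real inner product space with the same norm, so estimates live in [R]
    rather than in the partial order of [R[i]]. *)
Definition rip x y : R := complex.Re ⟪x, y⟫.
Definition sq x : R := rip x x.

Lemma ReD (u v : R[i]) : complex.Re (u + v) = complex.Re u + complex.Re v.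
Proof. by case: u v => [? ?] [? ?]. Qed.
Lemma ReN (u : R[i]) : complex.Re (- u) = - complex.Re u.
Proof. by case: u. Qed.
Lemma ReZ r (u : R[i]) : complex.Re (r%:C * u) = r * complex.Re u.
Proof. by case: u => [p q] /=; rewrite mul0r subr0. Qed.
Lemma conjCr r : Num.conj r%:C = r%:C.
Proof. by rewrite [LHS](conjc_real r). Qed.

Lemma ripDl x y z : rip (x + y) z = rip x z + rip y z.
Proof. by rewrite /rip innerDl ReD. Qed.
Lemma ripDr x y z : rip z (x + y) = rip z x + rip z y.
Proof. by rewrite /rip innerDr ReD. Qed.
Lemma ripBl x y z : rip (x - y) z = rip x z - rip y z.
Proof. by rewrite /rip innerBl ReD ReN. Qed.
Lemma ripBr x y z : rip z (x - y) = rip z x - rip z y.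
Proof. by rewrite /rip innerBr ReD ReN. Qed.
Lemma ripZl r x y : rip (r%:C *: x) y = r * rip x y.
Proof. by rewrite /rip innerZl ReZ. Qed.
Lemma ripZr r x y : rip x (r%:C *: y) = r * rip x y.
Proof. by rewrite /rip innerZr conjCr ReZ. Qed.
Lemma ripC x y : rip x y = rip y x.
Proof. by rewrite /rip innerC; case: ⟪y, x⟫. Qed.

Lemma sqE x : (sq x)%:C = `|x| ^+ 2.
Proof.
have h : `|x| ^+ 2 = ⟪x, x⟫ := inner_normE x.
have : 0 <= `|x| ^+ 2 by rewrite exprn_ge0.
by rewrite /sq /rip h => /ger0_real /RRe_real.
Qed.

Lemma sq_ge0 x : 0 <= sq x.
Proof. by rewrite -ler0c sqE exprn_ge0. Qed.

Lemma sq_eq0 x : sq x = 0 -> x = 0.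
Proof.
move=> h; apply/eqP; rewrite -normr_eq0 -sqrf_eq0 -sqE h; exact/eqP.
Qed.

Lemma sqD x y : sq (x + y) = sq x + 2 * rip x y + sq y.
Proof. by rewrite /sq ripDl !ripDr (ripC y x); ring. Qed.
Lemma sqB x y : sq (x - y) = sq x - 2 * rip x y + sq y.
Proof. by rewrite /sq ripBl !ripBr (ripC y x); ring. Qed.
Lemma sqZ r x : sq (r%:C *: x) = r ^+ 2 * sq x.
Proof. by rewrite /sq ripZl ripZr; ring. Qed.
Lemma sqN x : sq (- x) = sq x.
Proof. by rewrite -[- x]sub0r sqB /rip inner0l /sq /rip inner0l /=; ring. Qed.
Lemma rip_le x y : 2 * rip x y <= sq x + sq y.
Proof. by have := sq_ge0 (x - y); rewrite sqB; lra. Qed.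

(** Cauchy-Schwarz: expand the squared norm of [sq x * y - rip x y * x] and cancel [sq x]. *)
Lemma rip_sqr_le x y : rip x y ^+ 2 <= sq x * sq y.
Proof.
have [/sq_eq0 ->|x0] := eqVneq (sq x) 0.
  by rewrite /sq /rip !inner0l /= mul0r expr0n.
have xp : 0 < sq x by rewrite lt_def x0 sq_ge0.
have := sq_ge0 ((sq x)%:C *: y - (rip x y)%:C *: x).
by rewrite sqB ripZl ripZr !sqZ (ripC y x) => h; rewrite -(ler_pM2l xp); lra.
Qed.

Lemma normE x : `|x| = (Num.sqrt (sq x))%:C.
Proof.
apply/eqP; rewrite -(@eqrXn2 _ 2)// ?normr_ge0 ?ler0c ?sqrtr_ge0//.
by rewrite -sqE -rmorphXn sqr_sqrtr// sq_ge0.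
Qed.

Lemma inner_nondeg x y : (forall z, ⟪z, x⟫ = ⟪z, y⟫) -> x = y.
Proof.
move=> h; apply/eqP; rewrite -subr_eq0; apply/eqP/sq_eq0.
by rewrite /sq /rip innerBr h subrr.
Qed.

End InnerProduct.

(** * Boundedness and completeness in terms of real squared norms *)

Section Bounded.
Local Open Scope complex_scope.
Context {R : realType} {H : hilbertType R}.

Lemma bounded_opP (f : {linear H -> H}) : bounded_op f <->
  exists2 M : R, 0 <= M & forall x, sq (f x) <= M * sq x.
Proof.
split.
  move/linear_boundedP => [M [Mr hM]].
  (* The estimate is available only strictly above [M], hence the [+ 1]; the maximum with [0] makes
     squaring legitimate. *)
  set N := Num.max (complex.Re M + 1) 0.
  have MN : M < N%:C.
    by rewrite -(RRe_real Mr) ltcR /N lt_max ltrDl ltr01.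
  have N0 : 0 <= N by rewrite /N le_max lexx orbT.
  exists (N ^+ 2); first exact: exprn_ge0.
  move=> x; have := hM _ MN x.
  rewrite !normE -rmorphM lecR => h.
  rewrite -(sqr_sqrtr (sq_ge0 (f x))) -(sqr_sqrtr (sq_ge0 x)) -exprMn.
  by rewrite lerXn2r// nnegrE ?mulr_ge0// sqrtr_ge0.
move=> [M M0 hM]; apply/linear_boundedP.
exists (Num.sqrt M)%:C; split; first by rewrite complex_real.
move=> r Mr x.
apply: le_trans (_ : (Num.sqrt M)%:C * `|x| <= _).
  by rewrite !normE -rmorphM lecR -sqrtrM// ler_wsqrtr.
by rewrite ler_wpM2r// ltW.
Qed.

Lemma op_norm_le (f : H -> H) (M : R) : 0 <= M ->
  (forall x, sq (f x) <= M * sq x) -> (op_norm f <= (Num.sqrt M)%:E)%E.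
Proof.
move=> M0 h; apply: ub_ereal_sup => _ [x /= x1 <-].
rewrite lee_fin normE /= ler_wsqrtr//.
apply: le_trans (h x) _; rewrite ler_piMr// -lecR sqE.
by rewrite exprn_ile1.
Qed.

Definition scvg (u : nat -> H) (l : H) :=
  forall e : R, 0 < e -> exists N, forall n, (N <= n)%N -> sq (u n - l) < e.

Lemma hilbert_complete (u : nat -> H) :
  (forall e : R, 0 < e -> exists N, forall m n, (N <= m)%N -> (N <= n)%N ->
     sq (u m - u n) < e) ->
  exists l, scvg u l.
Proof.
move=> hu.
have lt_sq (x : H) (e : R) : 0 < e -> (`|x| < e%:C) = (sq x < e ^+ 2).
  move=> e0; rewrite normE ltcR -[in RHS](sqr_sqrtr (sq_ge0 x)).
  by rewrite ltr_pXn2r// nnegrE ?sqrtr_ge0// ltW.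
have cu : cvg (u @ \oo).
  apply/cauchy_cvgP/cauchy_exP => e e0.
  (* A positive element of [R[i]] is automatically real. *)
  have er : e = (complex.Re e)%:C by rewrite RRe_real// gtr0_real.
  have e1 : 0 < complex.Re e by rewrite -ltcR -er.
  have [N hN] := hu _ (exprn_gt0 2 e1).
  exists (u N); exists N => // n /= Nn.
  by rewrite -ball_normE /= er lt_sq//; apply: hN.
exists (lim (u @ \oo)) => e e0.
have s0 : 0 < Num.sqrt e by rewrite sqrtr_gt0.
have : 0 < (Num.sqrt e)%:C :> R[i] by rewrite ltcR.
move/cvgrPdist_lt : cu => /[apply] -[N _ hN].
exists N => n Nn; have := hN n Nn.
by rewrite /= distrC lt_sq// sqr_sqrtr// ltW.
Qed.

End Bounded.

(** * Two real growth lemmas *)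

Section RealLemmas.
Context {R : realType}.

Lemma bernoulli (q : R) n : 1 <= q -> 1 + n%:R * (q - 1) <= q ^+ n.
Proof.
move=> q1; elim: n => [|n IH]; first by rewrite expr0 mul0r addr0.
rewrite exprS -natr1.
have : 0 <= n%:R * (q - 1) ^+ 2 by rewrite mulr_ge0// sqr_ge0.
have : 0 <= (q - 1) * (q ^+ n - (1 + n%:R * (q - 1))).
  by rewrite mulr_ge0// subr_ge0.
lra.
Qed.

(** By log-convexity the ratios of consecutive terms never decrease. If the first ratio [r] exceeded
    [m], then [b k >= r ^ k * b 0], and [(r / m) ^ k] would stay bounded, against Bernoulli. *)
Lemma log_convex_growth (b : nat -> R) (m c : R) : 0 <= m ->
  (forall k, 0 <= b k) ->
  (forall k, b k.+1 ^+ 2 <= b k * b k.+2) ->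
  (forall k, b k <= c * m ^+ k) -> b 1%N <= m * b 0%N.
Proof.
move=> m0 b0 lc ub; rewrite leNgt; apply/negP => h.
have b00 : b 0%N != 0.
  apply/eqP => e; have := lc 0%N; rewrite e mul0r => h1.
  have b1 : 0 < b 1%N by move: h; rewrite e mulr0.
  by have := exprn_gt0 2 b1; rewrite ltNge h1.
have bp : 0 < b 0%N by rewrite lt_def b00 b0.
have mp : 0 < m.
  rewrite lt_def m0 andbT; apply/eqP => e.
  by have := ub 1%N; move: h; rewrite e expr1; nra.
set r := b 1%N / b 0%N.
have mr : m < r by rewrite /r ltr_pdivlMr.
have rp : 0 < r by apply: lt_trans mr.
have step k : 0 < b k /\ r * b k <= b k.+1.
  elim: k => [|k [kp IH]]; first by split => //; rewrite /r divfK.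
  have k1 : 0 < b k.+1 by apply: lt_le_trans IH; rewrite mulr_gt0.
  split => //; rewrite -(ler_pM2l kp); apply: le_trans (lc k).
  by rewrite mulrCA mulrA expr2 ler_pM2r//.
have lb k : r ^+ k * b 0%N <= b k.
  elim: k => [|k IH]; first by rewrite mul1r.
  have [_ +] := step k; rewrite exprS; nra.
have q1 : 1 < r / m by rewrite ltr_pdivlMr// mul1r.
have key k : (1 + k%:R * (r / m - 1)) * b 0%N <= c.
  apply: le_trans (_ : (r / m) ^+ k * b 0%N <= _).
    by rewrite ler_pM2r// bernoulli// ltW.
  rewrite expr_div_n mulrAC ler_pdivrMr ?exprn_gt0//.
  exact: le_trans (lb k) (ub k).
have c0 : 0 <= c / ((r / m - 1) * b 0%N).
  have := key 0%N; rewrite mul0r addr0 mul1r => cb.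
  by rewrite divr_ge0// ?mulr_ge0 ?subr_ge0 ?(ltW q1) ?(ltW bp)//; lra.
have qb : 0 < (r / m - 1) * b 0%N by rewrite mulr_gt0// subr_gt0.
have := archi_boundP c0; set k := Num.bound _.
rewrite ltr_pdivrMr// => kb; have := key k; nra.
Qed.

(** For small [t] the linear term dominates; [t = a / (b + 1)] works even when [b = 0]. *)
Lemma quadratic_le_eq0 (a b : R) : 0 <= b ->
  (forall t, t * a <= t ^+ 2 * b) -> a = 0.
Proof.
move=> b0 h; have b1 : 0 < b + 1 by lra.
have := h (a / (b + 1)); rewrite expr_div_n mulrAC.
rewrite ler_pdivrMr// => h1.
have e : a ^+ 2 / (b + 1) ^+ 2 * b * (b + 1) = a ^+ 2 * b / (b + 1).
  by field; rewrite gt_eqF.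
rewrite e ler_pdivlMr// in h1.
by apply/eqP; rewrite -sqrf_eq0; apply/eqP; have := sqr_ge0 a; nra.
Qed.

End RealLemmas.

(** * Convergence of sequences and orthogonal projection *)

Section Projection.
Local Open Scope complex_scope.
Context {R : realType} {H : hilbertType R}.

(** The real part of the product with [i y] is the imaginary part of the product with [y]. *)
Lemma inner_eq0_rip (x y : H) : rip x y = 0 -> rip x ('i%R *: y) = 0 ->
  ⟪x, y⟫ = 0.
Proof.
rewrite /rip innerZr conjc_i -complexiE; case: ⟪x, y⟫ => p q /= -> h.
by have -> : q = 0 by lra.
Qed.

Lemma small_sq_eq0 (x : H) (c : R) :
  (forall e, 0 < e -> sq x <= c * e) -> x = 0.
Proof.
move=> h; apply/sq_eq0/eqP; rewrite eq_le sq_ge0 andbT leNgt.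
apply/negP => x0.
have c1 : 0 < `|c| + 1 by apply: ltr_wpDl.
have cc : 0 < 2 * (`|c| + 1) by rewrite mulr_gt0.
have := h _ (divr_gt0 x0 cc).
rewrite mulrA ler_pdivlMr//.
have : c * sq x <= `|c| * sq x by rewrite ler_pM2r// ler_norm.
nra.
Qed.

Lemma sqD_le (x y : H) : sq (x + y) <= 2 * sq x + 2 * sq y.
Proof. by rewrite sqD; have := rip_le x y; lra. Qed.

Lemma sqB_le (x y : H) : sq (x - y) <= 2 * sq x + 2 * sq y.
Proof. by have := sqD_le x (- y); rewrite sqN. Qed.

Lemma scvg_cauchy (u : nat -> H) l : scvg u l -> forall e : R, 0 < e ->
  exists N, forall m n, (N <= m)%N -> (N <= n)%N -> sq (u m - u n) < e.
Proof.
move=> ul e e0; have e4 : 0 < e / 4 by lra.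
have [N hN] := ul _ e4; exists N => m n mN nN.
have -> : u m - u n = (u m - l) - (u n - l) by rewrite opprB addrA subrK.
apply: le_lt_trans (sqB_le _ _) _.
by have := hN _ mN; have := hN _ nN; lra.
Qed.

Lemma scvg_unique (u : nat -> H) l l' : scvg u l -> scvg u l' -> l = l'.
Proof.
move=> ul ul'; apply/eqP; rewrite -subr_eq0; apply/eqP.
apply: (@small_sq_eq0 _ 4) => e e0.
have [N hN] := ul _ e0; have [N' hN'] := ul' _ e0.
set n := maxn N N'.
have -> : l - l' = (u n - l') - (u n - l) by rewrite opprB [RHS]addrC subrKA.
apply: le_trans (sqB_le _ _) _.
have := hN n (leq_maxl _ _); have := hN' n (leq_maxr _ _); lra.
Qed.

Lemma scvgD (u v : nat -> H) a b : scvg u a -> scvg v b ->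
  scvg (fun n => u n + v n) (a + b).
Proof.
move=> ua vb e e0; have e4 : 0 < e / 4 by lra.
have [N hN] := ua _ e4; have [N' hN'] := vb _ e4.
exists (maxn N N') => n; rewrite geq_max => /andP[/hN h /hN' h'].
rewrite opprD addrACA; apply: le_lt_trans (sqD_le _ _) _; lra.
Qed.

Lemma scvg_rip (u : nat -> H) a (y : H) : scvg u a -> forall e : R, 0 < e ->
  exists N, forall n, (N <= n)%N -> `|rip y (u n) - rip y a| < e.
Proof.
move=> ua e e0; have y1 : 0 < sq y + 1 by have := sq_ge0 y; lra.
have d0 : 0 < e ^+ 2 / (sq y + 1) by rewrite divr_gt0// exprn_gt0.
have [N hN] := ua _ d0; exists N => n /hN.
rewrite ltr_pdivlMr// => h.
rewrite -ripBr -(@ltr_pXn2r _ 2)// ?nnegrE// ?(ltW e0)//.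
rewrite -normrX ger0_norm ?sqr_ge0//.
apply: le_lt_trans (rip_sqr_le _ _) _.
by apply: le_lt_trans h; have := sq_ge0 (u n - a); nra.
Qed.

(** A minimizing sequence for the distance from [w] to [D] is Cauchy by comparison with midpoints,
    and its limit is the foot of the perpendicular. *)
Lemma projection (D : set H) (w : H) : D 0 ->
  (forall x y, D x -> D y -> D (x + y)) ->
  (forall (a : R[i]) x, D x -> D (a *: x)) ->
  (forall u l, (forall n, D (u n)) -> scvg u l -> D l) ->
  exists2 p, D p & forall s, D s -> ⟪w - p, s⟫ = 0.
Proof.
move=> D0 DD DZ Dcl.
pose E := [set sq (w - r) | r in D].
have hE : has_inf E.
  split; first by exists (sq (w - 0)), 0.
  by exists 0 => _ [r _ <-]; exact: sq_ge0.
set d := inf E.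
have dle r : D r -> d <= sq (w - r).
  by move=> Dr; apply: ge_inf; [exact: hE.2|exists r].
have /choice[u hu] : forall n : nat,
    exists r, D r /\ sq (w - r) < d + n.+1%:R^-1.
  move=> n; have n0 : 0 < n.+1%:R^-1 :> R by rewrite invr_gt0.
  by have [_ [r Dr <-] hr] := inf_adherent n0 hE; exists r.
have small (e : R) : 0 < e -> exists N, forall n, (N <= n)%N ->
    sq (w - u n) < d + e.
  move=> e0; have ei : 0 <= e^-1 by rewrite invr_ge0 ltW.
  exists (Num.bound e^-1) => n nN.
  have [_ h] := hu n; apply: lt_le_trans h _; rewrite lerD2l.
  rewrite -[leRHS]invrK lef_pV2 ?posrE ?invr_gt0//.
  apply/ltW; apply: lt_le_trans (archi_boundP ei) _.
  by rewrite ler_nat ltnW.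
have [|p up] := @hilbert_complete _ _ u.
  move=> e e0; have e4 : 0 < e / 4 by lra.
  have [N hN] := small _ e4; exists N => m n mN nN.
  have Dmid : D ((2^-1 : R)%:C *: (u m + u n)).
    by apply: DZ; apply: DD; [exact: (hu m).1|exact: (hu n).1].
  have := dle _ Dmid; have := hN _ mN; have := hN _ nN.
  rewrite !sqB ripZr sqZ ripDr sqD.
  rewrite (_ : 2^-1 ^+ 2 = 4^-1 :> R); last by field.
  lra.
exists p; first by apply: Dcl up => n; exact: (hu n).1.
have orth s : D s -> rip (w - p) s = 0.
  (* Minimality is tested at [u n + t s] instead of [p + t s]. The cross term of [t s] with
     [u n - p] costs another [t ^ 2 * sq s], which the inequality proved here leaves room for. *)
  move=> Ds; apply: (quadratic_le_eq0 (b := sq s)) => [|t]; first exact: sq_ge0.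
  rewrite leNgt; apply/negP => h.
  set e := t * rip (w - p) s - t ^+ 2 * sq s.
  have e0 : 0 < e by rewrite subr_gt0.
  have e2 : 0 < e / 2 by lra.
  have [N hN] := small _ e2; have [N' hN'] := up _ e2.
  have := hN _ (leq_maxl N N'); have := hN' _ (leq_maxr N N').
  set n := maxn N N' => h1 h2.
  have Dn : D (u n + t%:C *: s) by apply: DD; [exact: (hu n).1|exact: DZ].
  have := dle _ Dn; have := rip_le (t%:C *: s) (u n - p).
  have -> : w - (u n + t%:C *: s) = (w - u n) - t%:C *: s.
    by rewrite opprD addrA.
  move: h h1 h2; rewrite /e !(sqB, ripBr, sqZ, ripZl, ripZr, ripBl).
  by rewrite (ripC s (u n)) (ripC s p); lra.
by move=> s Ds; apply: inner_eq0_rip; apply: orth => //; apply: DZ.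
Qed.

End Projection.

(** * Cayley transform of a linear relation self-adjoint for a definite form *)

Section Cayley.
Local Open Scope complex_scope.
Context {R : realType} {H : hilbertType R}.
Variables (G Gi : {linear H -> H}) (kappa M : R) (Th : set (H * H)).
Hypothesis kappa0 : 0 < kappa.
Hypothesis M0 : 0 <= M.
Hypothesis GK : forall x, G (Gi x) = x.
Hypothesis Gsym : forall x y, ⟪G x, y⟫ = ⟪x, G y⟫.
Hypothesis Gge : forall x, kappa * sq x <= rip (G x) x.
Hypothesis Gle : forall x, sq (G x) <= M * sq x.
(** Self-adjointness of [Th] for the inner product given by [G]; linearity and closedness of [Th]
    are derived from it. *)
Hypothesis ThP : forall u v, Th (u, v) <->
  forall a b, Th (a, b) -> ⟪b, G u⟫ = ⟪a, G v⟫.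

Lemma relation_lin (c : R[i]) u v u' v' : Th (u, v) -> Th (u', v') ->
  Th (c *: u + u', c *: v + v').
Proof.
move=> /ThP h /ThP h'; apply/ThP => a b ab.
by rewrite !linearP !innerDr !innerZr (h _ _ ab) (h' _ _ ab).
Qed.

Lemma relation0 : Th (0, 0).
Proof. by apply/ThP => a b _; rewrite linear0 !inner0r. Qed.

Lemma relationZ c u v : Th (u, v) -> Th (c *: u, c *: v).
Proof. by move=> h; have := relation_lin c h relation0; rewrite !addr0. Qed.

Lemma relationD u v u' v' : Th (u, v) -> Th (u', v') -> Th (u + u', v + v').
Proof. by move=> h h'; have := relation_lin 1 h h'; rewrite !scale1r. Qed.

Lemma relationB u v u' v' : Th (u, v) -> Th (u', v') -> Th (u - u', v - v').
Proof.
move=> h h'; have := relation_lin (-1) h' h.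
by rewrite !scaleN1r ![- _ + _]addrC.
Qed.

Lemma rip_G_le x : rip (G x) x <= (M + 1) * sq x.
Proof.
by have := rip_le (G x) x; have := Gle x; have := sq_ge0 x; have := M0; nra.
Qed.

Section Sign.
Variable s : R[i].
Hypothesis s2 : s * s = -1.
Hypothesis sJ : Num.conj s = - s.

(** Here [s] stands for both [i] and [-i]. The cross terms carry the factor [s + conj s = 0], and
    [s * conj s = 1]. *)
Lemma form_shift u v : Th (u, v) ->
  rip (G (v + s *: u)) (v + s *: u) = rip (G v) v + rip (G u) u.
Proof.
move=> h; have e : ⟪v, G u⟫ = ⟪u, G v⟫ by move/ThP: (h) => /(_ _ _ h).
rewrite /rip -ReD; congr complex.Re.
rewrite linearD linearZ !innerDl !innerDr !innerZl !innerZr !Gsym e sJ.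
by ring: s2.
Qed.

Lemma sq_shift u v : Th (u, v) ->
  kappa * (sq u + sq v) <= (M + 1) * sq (v + s *: u).
Proof.
move=> h; apply: le_trans (rip_G_le _); rewrite form_shift//.
by have := Gge u; have := Gge v; lra.
Qed.

(** [ThP] describes [Th] by equations continuous in [(u, v)]. The limit is taken in real parts;
    testing against [(i x, i y)] recovers the imaginary part. *)
Lemma relation_closed (u v : nat -> H) a b :
  (forall n, Th (u n, v n)) -> scvg u a -> scvg v b -> Th (a, b).
Proof.
move=> Thuv ua vb.
have ripP x y : Th (x, y) -> rip y (G a) = rip x (G b).
  move=> xy; apply/eqP; rewrite -subr_eq0 -normr_le0.
  apply/ler_addgt0Pr => e e0; rewrite add0r.
  have e2 : 0 < e / 2 by lra.
  have [N hN] := scvg_rip (G y) ua e2; have [N' hN'] := scvg_rip (G x) vb e2.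
  have := hN _ (leq_maxl N N'); have := hN' _ (leq_maxr N N').
  set n := maxn N N'.
  have : rip y (G (u n)) = rip x (G (v n)).
    by move/ThP: (Thuv n) => /(_ _ _ xy) h; rewrite /rip h.
  have ripG z t : rip (G z) t = rip z (G t) by rewrite /rip Gsym.
  rewrite !ripG => -> h1 h2; move: h1 h2.
  rewrite !ltr_norml => /andP[? ?] /andP[? ?].
  by rewrite ler_norml; apply/andP; split; lra.
apply/ThP => x y xy; apply/eqP; rewrite -subr_eq0; apply/eqP.
have := ripP _ _ (relationZ 'i%R xy); have := ripP _ _ xy.
rewrite /rip !innerZl -complexiE.
case: ⟪x, G b⟫ ⟪y, G a⟫ => [p q] [p' q'] /= -> h.
by apply/eqP; rewrite subr_eq0 eq_complex /= eqxx /=; apply/eqP; lra.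
Qed.

(** The range is closed because [sq_shift] bounds [u] and [v] by [v + s u]; it remains to show that
    its orthogonal complement is zero. *)
Lemma range_shift w : exists u v, Th (u, v) /\ v + s *: u = w.
Proof.
pose D := [set w | exists u v, Th (u, v) /\ v + s *: u = w].
have [|||f l|p [u [v [uv <-]]] orth] := @projection _ _ D w.
- by exists 0, 0; split; [exact: relation0|rewrite scaler0 addr0].
- move=> _ _ [u [v [h <-]]] [u' [v' [h' <-]]]; exists (u + u'), (v + v').
  by split; [exact: relationD|rewrite scalerDr addrACA].
- move=> a _ [u [v [h <-]]]; exists (a *: u), (a *: v).
  by split; [exact: relationZ|rewrite scalerDr !scalerA mulrC].
- move=> /choice[u /choice[v uvP]] fl.
  have Thuv n : Th (u n, v n) := (uvP n).1.
  have fE n : v n + s *: u n = f n := (uvP n).2.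
  have cauchy e : 0 < e -> exists N, forall m n, (N <= m)%N -> (N <= n)%N ->
      sq (u m - u n) < e /\ sq (v m - v n) < e.
    move=> e0; have d0 : 0 < kappa * e / (M + 1).
      by rewrite divr_gt0 ?mulr_gt0//; have := M0; lra.
    have [N hN] := scvg_cauchy fl d0; exists N => m n mN nN.
    have := hN _ _ mN nN; rewrite ltr_pdivlMr; last by have := M0; lra.
    have := sq_shift (relationB (Thuv m) (Thuv n)).
    rewrite scalerBr addrACA -opprD !fE.
    have := mulr_ge0 (ltW kappa0) (sq_ge0 (u m - u n)).
    have := mulr_ge0 (ltW kappa0) (sq_ge0 (v m - v n)).
    by move=> *; split; rewrite -(ltr_pM2l kappa0); lra.
  have [|a ua] := @hilbert_complete _ _ u.
    by move=> e /cauchy[N hN]; exists N => m n mN nN; exact: (hN m n mN nN).1.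
  have [|b vb] := @hilbert_complete _ _ v.
    by move=> e /cauchy[N hN]; exists N => m n mN nN; exact: (hN m n mN nN).2.
  exists a, b; split; first exact: relation_closed ua vb.
  apply: (@scvg_unique _ _ f) => //.
  have sua : scvg (fun n => s *: u n) (s *: a).
    move=> e e0; have [N hN] := ua _ e0; exists N => n /hN.
    suff h (x : H) : sq (s *: x) = sq x by rewrite -scalerBr h.
    by rewrite /sq /rip innerZl innerZr sJ mulrA mulrN s2 opprK mul1r.
  have := scvgD vb sua; congr scvg; exact/funext.
set e := w - _ in orth.
(* Orthogonality of [e] to the range is exactly the [ThP] criterion for this pair. Testing the pair
   against itself then makes the form vanish at [Gi e]. *)
have ThE : Th (Gi e, s *: Gi e).
  apply/ThP => a b ab; rewrite linearZ innerZr GK sJ mulNr.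
  have /orth : D (b + s *: a) by exists a, b.
  rewrite innerC => /eqP; rewrite conjC_eq0 innerDl innerZl addr_eq0.
  exact: eqP.
have e0 : e = 0.
  have /ThP/(_ _ _ ThE) := ThE; rewrite linearZ innerZl innerZr sJ GK => h.
  have s0 : s != 0.
    apply/eqP => z; move: s2; rewrite z mul0r => /eqP.
    by rewrite eq_sym oppr_eq0 oner_eq0.
  have : s * (2 * ⟪Gi e, e⟫) = 0.
    by rewrite mulrCA mulr_natl mulr2n {1}h mulNr addNr.
  move=> /eqP; rewrite !mulf_eq0 (negPf s0) pnatr_eq0 /= => /eqP z.
  have := Gge (Gi e); rewrite GK ripC /rip z /= pmulr_rle0// => g0.
  have /sq_eq0 ge0 : sq (Gi e) = 0 by apply/eqP; rewrite eq_le g0 sq_ge0.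
  by rewrite -(GK e) ge0 linear0.
by exists u, v; split => //; apply/eqP; rewrite eq_sym -subr_eq0; apply/eqP.
Qed.

End Sign.

Lemma iMi : 'i%R * 'i%R = -1 :> R[i].
Proof. by rewrite -expr2 sqrCi. Qed.

Lemma conjc_Ni : Num.conj (- 'i%R) = - (- 'i%R) :> R[i].
Proof. by rewrite rmorphN /= conjc_i. Qed.

(** The hypothesis cancels the cross terms on both sides. [F] is arbitrary so that both the definite
    and the indefinite form are covered. *)
Lemma cayley_form (F : {linear H -> H}) u v u' v' :
  ⟪v, F u'⟫ = ⟪u, F v'⟫ ->
  ⟪v + 'i%R *: u, F (v' + 'i%R *: u')⟫ =
  ⟪v - 'i%R *: u, F (v' - 'i%R *: u')⟫.
Proof.
move=> h.
have FD s : F (v' + s *: u') = F v' + s *: F u' by rewrite linearD linearZ_LR.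
rewrite -!scaleNr !FD !(innerDl, innerDr, innerZl, innerZr) rmorphN /=.
by rewrite conjc_i h; ring.
Qed.

(** Both vectors have the same value under the definite form of [G]. Applied to differences, this
    makes the transform and its inverse single-valued. *)
Lemma cayley_inj u v : Th (u, v) ->
  (v + 'i%R *: u = 0) <-> (v - 'i%R *: u = 0).
Proof.
move=> h; have /ThP/(_ _ _ h)/cayley_form e := h.
have nz x : ⟪x, G x⟫ = 0 -> x = 0.
  move=> x0; apply/sq_eq0/eqP; rewrite eq_le sq_ge0 andbT.
  rewrite -(pmulr_rle0 _ kappa0).
  by apply: le_trans (Gge _) _; rewrite /rip Gsym x0.
by split => z; apply: nz; [rewrite -e|rewrite e]; rewrite z inner0l.
Qed.

Lemma cayley_half (u v : H) : v + 'i%R *: u = 0 -> v - 'i%R *: u = 0 ->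
  u = 0 /\ v = 0.
Proof.
move=> h /eqP; rewrite subr_eq0 => /eqP e; move: h; rewrite e => /eqP.
rewrite -mulr2n -scaler_nat scalerA scaler_eq0 mulf_eq0 pnatr_eq0 /=.
have i0 : 'i%R != 0 :> R[i] by exact: neq0Ci.
by rewrite (negPf i0) => /eqP ->; rewrite scaler0.
Qed.

Lemma cayley_exists : exists K L : {linear H -> H},
  [/\ cancel K L, cancel L K,
      forall F : {linear H -> H}, (forall u v u' v', Th (u, v) -> Th (u', v') ->
        ⟪v, F u'⟫ = ⟪u, F v'⟫) ->
        forall x y, ⟪K x, F (K y)⟫ = ⟪x, F y⟫ &
      forall u v, Th (u, v) <-> K (v + 'i%R *: u) = v - 'i%R *: u].
Proof.
have i2 : (- 'i%R) * (- 'i%R) = -1 :> R[i] by rewrite mulrNN iMi.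
have /choice[up /choice[vp /all_and2[Thp sump]]] := range_shift iMi conjc_i.
have /choice[um /choice[vm /all_and2[Thm summ]]] := range_shift i2 conjc_Ni.
have scaleNi (x : H) : (- 'i%R) *: x = - ('i%R *: x) by rewrite scaleNr.
(* Chosen preimages under the two shifts define the transform and its inverse; [kE] and [lE] show
   independence of the choice, whence linearity. *)
pose k x := vp x - 'i%R *: up x; pose l x := vm x + 'i%R *: um x.
have kE u v : Th (u, v) -> k (v + 'i%R *: u) = v - 'i%R *: u.
  move=> h; apply/eqP; rewrite -subr_eq0 /k opprD addrACA -opprD -scalerBr.
  apply/eqP/(cayley_inj (relationB (Thp _) h)).
  by rewrite scalerBr addrACA -opprD sump subrr.
have lE u v : Th (u, v) -> l (v - 'i%R *: u) = v + 'i%R *: u.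
  move=> h; apply/eqP; rewrite -subr_eq0 /l opprD addrACA -scalerBr.
  apply/eqP/(cayley_inj (relationB (Thm _) h)).
  by rewrite scalerBr opprD addrACA -opprD -(scaleNi (um _)) summ subrr.
have shift_lin (c a : R[i]) (v v' u u' : H) :
    a *: v + v' + c *: (a *: u + u') = a *: (v + c *: u) + (v' + c *: u').
  by rewrite !scalerDr !scalerA (mulrC a) addrACA.
have klin : linear k.
  move=> a x y; rewrite -{1}(sump x) -{1}(sump y) -shift_lin kE.
    by rewrite /k -!scaleNi shift_lin.
  exact: relation_lin.
have llin : linear l.
  move=> a x y; rewrite -{1}(summ x) -{1}(summ y) -shift_lin scaleNi lE.
    by rewrite /l shift_lin.
  exact: relation_lin.
pose Kl := GRing.isLinear.Build _ _ _ _ k klin.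
pose K : {linear H -> H} := HB.pack k Kl.
pose Ll := GRing.isLinear.Build _ _ _ _ l llin.
pose L : {linear H -> H} := HB.pack l Ll.
exists K, L; split.
- by move=> x /=; rewrite /K /L /= /k lE.
- by move=> x /=; rewrite /K /L /= /l kE// -scaleNi.
- move=> F hF x y; rewrite -{2}(sump x) -{2}(sump y); apply/esym.
  by rewrite (cayley_form (hF _ _ _ _ (Thp x) (Thp y))).
- move=> u v; split; first exact: kE.
  (* The chosen pair for [w] and [(u, v)] agree under both shifts, hence coincide by
     [cayley_half]. *)
  set w := v + _ => /= kw; have hw := sump w; rewrite /= /k in kw.
  have [] := @cayley_half (up w - u) (vp w - v).
    by rewrite scalerBr addrACA -opprD hw subrr.
    by rewrite scalerBr opprD addrACA -opprD kw subrr.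
  move=> /eqP; rewrite subr_eq0 => /eqP <- /eqP; rewrite subr_eq0 => /eqP <-.
  exact: Thp.
Qed.

End Cayley.

(** * Graphs, adjoints and coercivity *)

Section Operators.
Local Open Scope complex_scope.
Context {R : realType} {H : hilbertType R}.

Lemma domI (T : set (H * H)) x y : T (x, y) -> dom T x.
Proof. by exists y. Qed.

Lemma commutes_img (T : set (H * H)) (f : H -> H) x y :
  commutes T f -> T (x, y) -> T (f x, f y).
Proof.
move=> e Txy.
have : Defs.comp (gr f) T (x, f y) by exists y.
by rewrite -e => -[z []]; rewrite {1}/gr /= => ->.
Qed.

Lemma self_adjoint_gr (f : H -> H) : self_adjoint (gr f) ->
  forall x y, ⟪f x, y⟫ = ⟪x, f y⟫.
Proof.
move=> e x y.
have : gr f (y, f y) by [].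
by rewrite -[X in X (y, _)]e => /(_ x (f x)) /=; apply.
Qed.

Lemma adjoint_img (T : set (H * H)) (f : H -> H) :
  (forall x y, ⟪f x, y⟫ = ⟪x, f y⟫) ->
  (forall x y, T (x, y) -> T (f x, f y)) ->
  forall x y, adjoint T (x, y) -> adjoint T (f x, f y).
Proof. by move=> fs Tf x y xy a b ab /=; rewrite -!fs; apply/xy/Tf. Qed.

Lemma adjoint_sub (T U : set (H * H)) : T `<=` U -> adjoint U `<=` adjoint T.
Proof. by move=> TU p Up x y /TU; exact: Up. Qed.

(* An upper bound on [N - G], unlike the coercivity of [G] itself, passes to the
   boundary space by [boundary_op_bound]. *)
Lemma coercive_gap (G : {linear H -> H}) (N : R) : 1 <= N ->
  (forall x y, ⟪G x, y⟫ = ⟪x, G y⟫) ->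
  (forall x, 0 <= rip (G x) x) ->
  (forall x, sq (G x) <= N ^+ 2 * sq x) ->
  (forall x, sq x <= N ^+ 2 * sq (G x)) ->
  forall x, sq (N%:C *: x - G x) <= (N ^+ 2 - N ^- 2) * sq x.
Proof.
move=> N1 Gs Gp Gle Gge x.
have N0 : 0 < N by lra.
have GN y : rip (G y) y <= N * sq y.
  rewrite -(ler_pM2l N0); have := rip_le (G y) (N%:C *: y).
  by rewrite ripZr sqZ; have := Gle y; lra.
(* Positivity of [G] at [N x - G x], combined with [G <= N] at [G x], gives [G ^ 2 <= N G]. *)
have G2 : sq (G x) <= N * rip (G x) x.
  have := Gp (N%:C *: x - G x).
  rewrite linearB linearZ_LR !(ripBl, ripBr, ripZl, ripZr).
  have -> : rip (G (G x)) x = sq (G x) by rewrite /rip Gs.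
  have := GN (G x); rewrite -/(sq (G x)) => h1 h2.
  by rewrite -(ler_pM2l N0); lra.
have low : N ^- 2 * sq x <= N * rip (G x) x.
  apply: le_trans G2; rewrite mulrC ler_pdivrMr ?exprn_gt0// mulrC; exact: Gge.
by rewrite sqB ripZl sqZ (ripC x); lra.
Qed.

(** Expand the square and drop the nonnegative term [sq (G x)]. *)
Lemma coercive_of_gap (G : H -> H) (N d : R) : 0 < N ->
  (forall x, sq (N%:C *: x - G x) <= (N ^+ 2 - d) * sq x) ->
  forall x, d / (2 * N) * sq x <= rip (G x) x.
Proof.
move=> N0 h x; have := h x; rewrite sqB ripZl sqZ (ripC x) => hx.
rewrite mulrAC ler_pdivrMr; last by lra.
by have := sq_ge0 (G x); lra.
Qed.

Lemma adjoint_lin (T : set (H * H)) (a : R[i]) x x' y y' :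
  adjoint T (x, x') -> adjoint T (y, y') ->
  adjoint T (a *: x + y, a *: x' + y').
Proof.
by move=> hx hy u v uv /=; rewrite !innerDr !innerZr (hx _ _ uv) (hy _ _ uv).
Qed.

End Operators.

(** * Operators induced on the boundary space *)

Section BoundaryOperators.
Local Open Scope complex_scope.
Context {R : realType} {H Hb : hilbertType R}.
Variables (S : set (H * H)) (G0 G1 : H -> Hb).
Hypothesis hG : boundary_triplet S G0 G1.

Lemma boundary_sub (g : H -> Hb) (a : R[i]) x x' y y' :
  linear_on (dom (adjoint S)) g -> adjoint S (x, x') -> adjoint S (y, y') ->
  g (a *: x - y) = a *: g x - g y.
Proof.
move=> gl hx hy.
have h0 : adjoint S (0, 0) by move=> u v _ /=; rewrite !inner0r.
have g0 : g 0 = 0.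
  have := gl 1 _ _ (domI h0) (domI h0); rewrite !scale1r addr0 => e.
  by apply: (addrI (g 0)); rewrite addr0 -e.
rewrite addrC -scaleN1r gl ?scaleN1r; [|exact: domI hy|].
  have := gl a _ _ (domI hx) (domI h0); rewrite g0 !addr0 => ->.
  by rewrite addrC.
by have := domI (adjoint_lin a hx h0); rewrite addr0.
Qed.

Lemma green x x' y y' : adjoint S (x, x') -> adjoint S (y, y') ->
  ⟪x', y⟫ - ⟪x, y'⟫ = ⟪G1 x, G0 y⟫ - ⟪G0 x, G1 y⟫.
Proof. by case: hG => _ _ + _; apply. Qed.

Lemma boundary_surj u v : exists f f',
  [/\ adjoint S (f, f'), G0 f = u & G1 f = v].
Proof.
by case: hG => _ _ _ /(_ u v) [f [[f' ff'] <- <-]]; exists f, f'.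
Qed.

Variables (T : {linear H -> H}) (cT : {linear Hb -> Hb}).
Hypothesis Tsym : forall x y, ⟪T x, y⟫ = ⟪x, T y⟫.
Hypothesis TS : forall x y, adjoint S (x, y) -> adjoint S (T x, T y).
Hypothesis hT : boundary_image S G0 G1 T cT.

(** With boundary data [(0, u)] for [f] and [(v, 0)] for [g], Green's identity for [(T f, g)] and
    for [(f, T g)] isolates the two sides. *)
Lemma boundary_op_sym u v : ⟪cT u, v⟫ = ⟪u, cT v⟫.
Proof.
have [f [f' [ff' f0 f1]]] := boundary_surj 0 u.
have [g [g' [gg' g0 g1]]] := boundary_surj v 0.
have [e0 e1] := hT (domI ff').
have [d0 d1] := hT (domI gg').
have := green (TS ff') gg'; rewrite -e0 -e1 f0 f1 g0 g1 linear0.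
rewrite !(inner0l, inner0r) !subr0 => <-.
have := green ff' (TS gg'); rewrite -d0 -d1 f0 f1 g0 g1 linear0.
rewrite !(inner0l, inner0r) !subr0 => <-.
by rewrite !Tsym.
Qed.

(* Green's identity for [T^k f] and [T^k g], where [f] and [g] have boundary data
   [(0, x)] and [(x, 0)], reads [|cT^k x|^2 = (T^k f', T^k g) - (T^k f, T^k g')],
   which is [O(m^k)]; log-convexity in [k] then removes the constant. *)
Lemma boundary_op_bound (m : R) : 0 <= m ->
  (forall x, sq (T x) <= m * sq x) -> forall x, sq (cT x) <= m * sq x.
Proof.
move=> m0 hm x.
have [f [f' [ff' f0 f1]]] := boundary_surj 0 x.
have [g [g' [gg' g0 g1]]] := boundary_surj x 0.
have T_iter k y y' : adjoint S (y, y') ->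
    [/\ adjoint S (iter k T y, iter k T y'),
        G0 (iter k T y) = iter k cT (G0 y) &
        G1 (iter k T y) = iter k cT (G1 y)].
  move=> yy'; elim: k => [//|k [h h0 h1]] /=.
  have [<- <-] := hT (domI h).
  by split; [exact: TS|rewrite h0|rewrite h1].
have iterb k y : sq (iter k T y) <= m ^+ k * sq y.
  elim: k => [|k IH]; first by rewrite mul1r.
  by rewrite exprS -mulrA /=; apply: le_trans (hm _) _; rewrite ler_wpM2l.
have iter0 k : iter k cT 0 = 0 by elim: k => //= k ->; rewrite linear0.
pose b k := sq (iter k cT x).
pose c := (sq f' + sq g + sq f + sq g') / 2.
apply: (@log_convex_growth _ b m c) => //.
- by move=> k; exact: sq_ge0.
(* Log-convexity: move one factor [cT] across by symmetry, then apply Cauchy-Schwarz. *)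
- move=> k; have -> : b k.+1 = rip (iter k cT x) (iter k.+2 cT x).
    by rewrite /b /sq /rip /= boundary_op_sym.
  exact: rip_sqr_le.
- move=> k.
  have [h h0 h1] := T_iter k _ _ ff'; have [d d0 d1] := T_iter k _ _ gg'.
  have := green h d; rewrite h0 h1 d0 d1 f0 f1 g0 g1 iter0 inner0l subr0 => e.
  rewrite /b /sq /rip -e ReD ReN -/(rip _ _) -/(rip (iter k T f) _).
  have := rip_le (iter k T f') (iter k T g).
  have := rip_le (- iter k T f) (iter k T g').
  rewrite sqN -[- iter k T f]sub0r ripBl [rip 0 _]/rip inner0l /=.
  have := iterb k f; have := iterb k g; have := iterb k f'; have := iterb k g'.
  by rewrite /c; lra.
Qed.

End BoundaryOperators.

(** * Construction of [K] from the boundary values of [A] *)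

Theorem theorem3p15 (R : realType) (H Hb : hilbertType R)
  (S : set (H * H)) (J : {linear H -> H}) (G0 G1 : H -> Hb)
  (cJ : {linear Hb -> Hb})
  (hS : symmetric_operator S)
  (hdef : equal_defect_numbers S)
  (hJ : fundamental_symmetry J)
  (hJnt : nontrivial_op J)
  (hSJ : commutes S J)
  (hG : boundary_triplet S G0 G1)
  (hC : forall C : {linear H -> H}, C_symmetry S J C ->
    exists! cC : {linear Hb -> Hb}, boundary_image S G0 G1 C cC)
  (hcJ : boundary_image S G0 G1 J cJ)
  (A : set (H * H)) (hA : SigmaJ_st S J A) :
  exists K : {linear Hb -> Hb},
    [/\ J_unitary cJ K, stable_op K &
      A = [set p | adjoint S p /\
                   K (Omega_plus G0 G1 p.1) = Omega_minus G0 G1 p.1]].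
Proof.
have [_ /self_adjoint_gr Js JJ] := hJ.
have [[[_ _ AJ] SA] [C [hCsym AC]]] := hA.
have [Cb CC /self_adjoint_gr Gs Gpos SC] := hCsym.
have [cC [hcC _]] := hC _ hCsym.
pose G : {linear H -> H} := J \o C.
pose cG : {linear Hb -> Hb} := cJ \o cC.
have GE x : G x = J (C x) by [].
have cGE x : cG x = cJ (cC x) by [].
have SG x y : S (x, y) -> S (G x, G y).
  by move=> h; apply: (commutes_img hSJ); apply: (commutes_img SC).
have adjJ := adjoint_img Js (fun x y => @commutes_img _ _ _ _ x y hSJ).
have adjG := adjoint_img Gs SG.
(* [adjoint_img] needs a symmetric operator, so [C] is handled as [J G]. *)
have adjC x y : adjoint S (x, y) -> adjoint S (C x, C y).
  by move=> /adjG/adjJ; rewrite !GE !JJ.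
have hcG : boundary_image S G0 G1 G cG.
  move=> f [f' ff']; have [e0 e1] := hcC _ (domI ff').
  have [d0 d1] := hcJ _ (domI (adjC _ _ ff')).
  by rewrite !cGE e0 e1 d0 d1.
have sqJ x : sq (J x) = sq x by rewrite /sq /rip Js JJ.
have [M M0 hM] := (bounded_opP C).1 Cb.
pose N := M + 1.
have N1 : 1 <= N by rewrite /N; lra.
have N0 : 0 < N by lra.
have MN x : M * sq x <= N ^+ 2 * sq (x : H).
  by rewrite ler_wpM2r ?sq_ge0// /N; nra.
have Gle x : sq (G x) <= N ^+ 2 * sq x.
  by rewrite GE sqJ; apply: le_trans (hM x) _.
(* [C] is its own inverse, so its upper bound is also a lower bound; [J] is isometric. *)
have Gge x : sq x <= N ^+ 2 * sq (G x).
  by rewrite GE sqJ -{1}(CC x); apply: le_trans (hM _) _.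
have Gp x : 0 <= rip (G x) x.
  have [->|x0] := eqVneq x 0; first by rewrite linear0 /rip inner0l.
  by have := Gpos _ x0; rewrite ltcE => /andP[_ /ltW].
have cGs := boundary_op_sym hG Gs adjG hcG.
have cGle : forall x, sq (cG x) <= N ^+ 2 * sq x.
  by apply: (boundary_op_bound hG Gs adjG hcG) => //; exact: exprn_ge0 (ltW N0).
pose kappa := N ^- 2 / (2 * N).
have kappa0 : 0 < kappa by rewrite divr_gt0 ?invr_gt0 ?exprn_gt0 ?mulr_gt0.
have cGge x : kappa * sq x <= rip (cG x) x.
  apply: (@coercive_of_gap _ _ cG) => // {}x.
  pose T : {linear H -> H} := N%:C%C \*: idfun \- G.
  pose cT : {linear Hb -> Hb} := N%:C%C \*: idfun \- cG.
  have TE y : T y = N%:C%C *: y - G y by [].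
  have cTE y : cT y = N%:C%C *: y - cG y by [].
  have Ts x1 y : ⟪T x1, y⟫ = ⟪x1, T y⟫.
    by rewrite !TE innerBl innerBr innerZl innerZr conjCr Gs.
  have adjT x1 y : adjoint S (x1, y) -> adjoint S (T x1, T y).
    move=> h; have g := adjG _ _ h => a b ab.
    change (⟪b, T x1⟫ = ⟪a, T y⟫).
    by rewrite !TE !innerBr !innerZr (h _ _ ab) (g _ _ ab).
  have hcT : boundary_image S G0 G1 T cT.
    have [l0 l1 _ _] := hG.
    move=> f [f' ff']; rewrite !cTE !TE.
    have [-> ->] := hcG _ (domI ff').
    have h := adjG _ _ ff'.
    by rewrite !(boundary_sub _ l0 ff' h) !(boundary_sub _ l1 ff' h).
  rewrite -cTE; apply: (boundary_op_bound hG Ts adjT hcT) => [|y].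
    rewrite subr_ge0; apply: (@le_trans _ _ 1); last exact: exprn_ege1.
    by rewrite invf_le1 ?exprn_gt0 ?exprn_ege1.
  exact: coercive_gap.
have cGK x : cG (cC (cJ x)) = x.
  have [f [f' [ff' f0 _]]] := boundary_surj hG x 0.
  have [d0 _] := hcJ _ (domI ff').
  have h1 := adjC _ _ (adjJ _ _ ff').
  have [e0 _] := hcC _ (domI (adjJ _ _ ff')).
  have [g0 _] := hcG _ (domI h1).
  by rewrite -f0 d0 e0 g0 GE CC JJ.
pose Th := [set q | exists f f', [/\ A (f, f'), G0 f = q.1 & G1 f = q.2]].
(* The equality [A* J = J A] read on graphs, using that [J] is an involution. *)
have AdjA x y : A (x, y) <-> adjoint A (J x, J y).
  have : Defs.comp (adjoint A) (gr J) (x, J y) <->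
      Defs.comp (gr J) A (x, J y) by rewrite AJ.
  move=> [h1 h2]; split=> [xy|xy].
    have [|z []] := h2; first by exists y.
    by rewrite {1}/gr /= => ->.
  have [|z [/= xz]] := h1; first by exists (J x).
  by rewrite /gr /= => /(congr1 J); rewrite !JJ => ->.
have AadjS : A `<=` adjoint S.
  move=> [x y] /AdjA/(adjoint_sub SA)/adjJ; by rewrite !JJ.
have ACP x y : A (x, y) <-> A (C x, C y).
  by split=> [|/(commutes_img AC)]; [exact: commutes_img|rewrite !CC].
(* Applying [C] and then [J], membership in [A] becomes membership of [(G f, G f')] in [A*], which
   Green's identity expresses through boundary values alone. *)
have AP f f' : adjoint S (f, f') -> (A (f, f') <->
    forall a b, Th (a, b) -> ⟪b, cG (G0 f)⟫ = ⟪a, cG (G1 f)⟫).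
  move=> ff'; rewrite ACP AdjA -!GE.
  have [-> ->] := hcG _ (domI ff').
  split=> [h a b [g [g' [gg' /= <- <-]]]|h a b ab].
    have := green hG (AadjS _ gg') (adjG _ _ ff').
    by rewrite (h _ _ gg') subrr => /esym/eqP; rewrite subr_eq0 => /eqP.
  have := green hG (AadjS _ ab) (adjG _ _ ff').
  rewrite (h (G0 a) (G1 a)) ?subrr; last by exists a, b.
  by move=> /eqP; rewrite subr_eq0 => /eqP.
have AThP f f' : adjoint S (f, f') -> (A (f, f') <-> Th (G0 f, G1 f)).
  move=> ff'; split=> [h|[g [g' [gg' /= g0 g1]]]]; first by exists f, f'.
  by apply/(AP _ _ ff'); rewrite -g0 -g1; exact/(AP _ _ (AadjS _ gg')).
have ThP u v : Th (u, v) <-> forall a b, Th (a, b) -> ⟪b, cG u⟫ = ⟪a, cG v⟫.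
  have [f [f' [ff' <- <-]]] := boundary_surj hG u v.
  exact: iff_trans (iff_sym (AThP _ _ ff')) (AP _ _ ff').
pose cGi : {linear Hb -> Hb} := cC \o cJ.
have [K [L [KL LK Kform KTh]]] :=
  cayley_exists (Gi := cGi) kappa0 (exprn_ge0 2 (ltW N0)) cGK cGs cGge cGle ThP.
(* Ratio of the upper and lower constants comparing the [cG] form with the norm: every map
   preserving that form satisfies this bound. *)
pose B := (N ^+ 2 + 1) / kappa.
have B0 : 0 <= B by rewrite divr_ge0 ?(ltW kappa0)// addr_ge0// exprn_ge0// ltW.
have isoB f : (forall x, ⟪f x, cG (f x)⟫ = ⟪x, cG x⟫) ->
    forall x, sq (f x) <= B * sq x.
  move=> hf x; rewrite /B mulrAC ler_pdivlMr// mulrC.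
  apply: le_trans (cGge _) _.
  rewrite /rip cGs hf -cGs.
  exact: (rip_G_le (exprn_ge0 2 (ltW N0)) cGle).
have KcG x : ⟪K x, cG (K x)⟫ = ⟪x, cG x⟫.
  by apply: Kform => u v u' v' h /ThP; apply.
have LcG x : ⟪L x, cG (L x)⟫ = ⟪x, cG x⟫ by rewrite -KcG LK.
exists K; split.
- split.
  + by apply/bounded_opP; exists B => //; exact: isoB.
  + exists L; split => //; apply/bounded_opP; exists B => //; exact: isoB.
  (* [(J g, J g')] lies in [A*], so the left side of Green's identity with [(f, f')] vanishes and
     [Th] is symmetric for the [cJ] form. *)
  + have KcJ x y : ⟪K x, cJ (K y)⟫ = ⟪x, cJ y⟫.
      apply: Kform => u v _ _ [f [f' [ff' /= <- <-]]] [g [g' [gg' /= <- <-]]].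
      have gS := AadjS _ gg'.
      have [-> ->] := hcJ _ (domI gS).
      have := green hG (AadjS _ ff') (adjJ _ _ gS).
      have /AdjA/(_ _ _ ff') /= -> := gg'.
      by rewrite subrr => /esym/eqP; rewrite subr_eq0 => /eqP.
    apply/seteqP; split=> -[x y].
      move=> [z [[t []]]]; rewrite /gr /= => -> -> h.
      by apply: inner_nondeg => a; rewrite -KcJ (h a (K a) erefl).
    rewrite {1}/gr /= => ->; exists (cJ (K x)); split; first by exists (K x).
    by move=> a b; rewrite /gr /= => ->; rewrite KcJ.
- exists L; split => //.
  apply: (@le_lt_trans _ _ (Num.sqrt B)%:E); last exact: ltry.
  apply: ub_ereal_sup => _ [n _ <-]; apply: op_norm_le => //; apply: isoB.
  (* All powers of [K] and [L] preserve the [cG] form, so [B] serves uniformly in [n]. *)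
  have iter_iso f : (forall x, ⟪f x, cG (f x)⟫ = ⟪x, cG x⟫) ->
      forall n x, ⟪iter n f x, cG (iter n f x)⟫ = ⟪x, cG x⟫.
    by move=> hf; elim=> // k IH x; rewrite iterS hf.
  by case: n => n; apply: iter_iso.
- have KO f : K (Omega_plus G0 G1 f) = Omega_minus G0 G1 f <->
      K (G1 f + 'i%R *: G0 f) = G1 f - 'i%R *: G0 f.
    rewrite /Omega_plus /Omega_minus linearZ_LR; split=> [/scalerI|-> //].
    by apply; rewrite invr_eq0 sqrtC_eq0 pnatr_eq0.
  apply/seteqP; split=> -[f f'] /=.
    by move=> h; split; [exact: AadjS|exact/KO/KTh/(AThP _ _ (AadjS _ h))].
  by move=> [h /KO/KTh k]; apply/(AThP _ _ h).
Qed.
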